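(* Let $\Pi_{1,\mathsf{ED}}$ be the edit-distance-one conditional encryption construction described in the context, with message space $\Sigma^{\le n}$ and predicate $P_{1,\mathsf{ED}}$, where $P_{1,\mathsf{ED}}(m,m')=1$ if and only if $\mathsf{ED}(m,m')\le1$. Then $\Pi_{1,\mathsf{ED}}$ provides $(\infty,t_{\mathsf{Sim}},0)$-conditional encryption secrecy for the predicate $P_{1,\mathsf{ED}}$, where $t_{\mathsf{Sim}}=(2n+1)t_{\mathsf{P.Enc}}$ is the time of doing $2n+1$ Paillier encryptions.
   Context: **Conditional encryption.** For a binary predicate $P:\mathcal M\times\mathcal M\to\{0,1\}$, a conditional encryption scheme consists of algorithms $(\mathsf{KeyGen},\mathsf{Enc},\mathsf{CondEnc},\mathsf{Dec})$: $(sk,pk)=\mathsf{KeyGen}(1^\lambda;r)$; $\mathsf{Enc}_{pk}(m_1;r)$ outputs a ciphertext with flag $0$; $\mathsf{CondEnc}_{pk}(c,m_2,m_3;r)$ takes a regular (flag $0$) ciphertext, a control message $m_2$ and a payload message $m_3$ and outputs a ciphertext with flag $1$ (and outputs $\bot$ if the input ciphertext has flag $1$); $\mathsf{Dec}_{sk}$ outputs a message in $\mathcal M$ or $\bot$. *Conditional encryption secrecy.* The scheme provides $(t,t_{\mathsf{Sim}},\epsilon)$-conditional encryption secrecy if there is a simulator $\mathsf{Sim}$ running in time at most $t_{\mathsf{Sim}}(\lambda)$ such that for all $m_1,m_2,m_3\in\mathcal M$ with $P(m_1,m_2)=0$, all $\lambda$, all coins $r,r_1$, and all distinguishers $\mathcal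 D$ running in time at most $t(\lambda)$, with $(sk,pk)=\mathsf{KeyGen}(1^\lambda;r)$ and $c_1=\mathsf{Enc}_{pk}(m_1;r_1)$, $$\big|\Pr[\mathcal D(sk,pk,m_1,m_2,m_3,c_1,\mathsf{Sim}(pk))=1]-\Pr[\mathcal D(sk,pk,m_1,m_2,m_3,c_1,\mathsf{CondEnc}_{pk}(c_1,m_2,m_3))=1]\big|\le\epsilon(t(\lambda),\lambda),$$ probabilities over the coins of $\mathcal D$, $\mathsf{Sim}$ and $\mathsf{CondEnc}$. With $t=\infty$ and $\epsilon=0$ this is perfect secrecy (unbounded distinguishers, zero advantage). **Paillier.** Public key $(N,g)$, $N=pq$ with $p,q$ distinct primes, $\gcd(N,(p-1)(q-1))=1$, $g=N+1$; encryption of $m\in\mathbb Z_N$ with nonce $r\in\mathbb Z_N^*$: $\mathsf{P.Enc}_{pk}(m;r)=g^mr^N\bmod N^2$; decryption $\mathsf{P.Dec}_{sk}(c)$ of $c\in\mathbb Z_{N^2}^*$ returns the unique $m\in\mathbb Z_N$ such that $c=g^mr^N\bmod N^2$ for some $r\in\mathbb Z_N^*$, computed from the factorization of $N$. **Edit distance.** $\Sigma$ is a finite alphabet, $\Sigma^{\le n}$ the set of strings of length at most $n$; $\mathsf{ED}(m,m')$ is the minimum number of single-character insertions/deletions transforming $m$ into $m'$. For a string $m$, $m_{-i}$ is $m$ with its $i$th character deleted, and $m_{-i}=m$ if $i=0$ or $i>|m|$. $\mathsf{ToInt}:\Sigma^{\le n}\to\mathbb Z_{|\Sigma|^{n+1}}$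 is a fixed injective map and $\mathsf{ToInt}^{-1}(y)$ is the preimage of $y$, or $\bot$ if there is none. **The construction $\Pi_{1,\mathsf{ED}}$.** For a Paillier ciphertext $c$ and messages $m_2,m_3$ let $\mathsf{CondEnc}^=_{pk}(c,m_2,m_3)=c^R(N+1)^{-R\,\mathsf{ToInt}(m_2)+\mathsf{ToInt}(m_3)}r^N\bmod N^2$ with fresh uniform $R\in\mathbb Z_N$, $r\in\mathbb Z_N^*$ (and $\bot$ if $\gcd(c,N)\neq1$). - $\mathsf{KeyGen}$: Paillier key generation with $\min\{p,q\}\ge|\Sigma|^{n+1}$ and $\gcd(N,(p-1)(q-1))=1$. - $\mathsf{Enc}_{pk}(m)=(0,c[0],\dots,c[n])$ with $c[i]=\mathsf{P.Enc}_{pk}(\mathsf{ToInt}(m_{-i}))$, fresh nonces. - $\mathsf{CondEnc}_{pk}((0,c[0],\dots,c[n]),m',m'')=(1,\tilde c_0,\dots,\tilde c_{2n})$ with $\tilde c_i=\mathsf{CondEnc}^=_{pk}(c[i],m',m'')$ for $0\le i\le n$ and $\tilde c_{n+i}=\mathsf{CondEnc}^=_{pk}(c[0],m'_{-i},m'')$ for $1\le i\le n$; output $\bot$ if some $\tilde c_j=\bot$. - $\mathsf{Dec}_{sk}(0,c[0],\dots,c[n])=\mathsf{ToInt}^{-1}(\mathsf{P.Dec}_{sk}(c[0]))$. For $(1,\tilde c_0,\dots,\tilde c_{2n})$ compute $x_i=\mathsf{P.Dec}_{sk}(\tilde c_i)$; if $\min_i x_i>|\Sigma|^{n+1}$ output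 $\bot$, otherwise output $\mathsf{ToInt}^{-1}(\min_i x_i)$. *)

(* Defs.v *)
From mathcomp Require Import all_boot all_order all_algebra.

Set Implicit Arguments.
Unset Strict Implicit.
Unset Printing Implicit Defensive.

Import Order.TTheory GRing.Theory Num.Theory.
Local Open Scope nat_scope.

(** * A machine model *)

(** Keys and ciphertexts are finite sequences of natural numbers. *)
Definition data := seq nat.

(** The units of Z_N, as canonical representatives. *)
Definition Zstar (N : nat) := {r : 'I_N | coprime r N}.

(** Expectation of [f] under the uniform distribution on [T]. *)
Definition avg (R : realFieldType) (T : finType) (f : T -> R) : R :=
  ((\sum_(x : T) f x) / #|T|%:R)%R.

(** Probabilistic, loop-free programs over integer registers.  Every
    instruction that produces a value pushes it in front of the memory, so
    [Reg i] is the [i]-th most recent value; the input occupies the memory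
    initially, and unused addresses read as 0. *)
Inductive operand := Reg of nat | Lit of nat.

Inductive opcode := Add | Sub | Mul | Div | Mod | PowMod.

Inductive prog :=
| Out of seq operand
| Op of opcode & operand & operand & operand & prog
| IfLt of operand & operand & prog & prog
| Coin of operand & prog
| UnitCoin of operand & prog.

Definition read (mem : data) (a : operand) : nat :=
  match a with Reg i => nth 0 mem i | Lit k => k end.

Definition eval_op (o : opcode) (x y z : nat) : nat :=
  match o with
  | Add => x + y
  | Sub => x - y
  | Mul => x * y
  | Div => x %/ y
  | Mod => x %% y
  | PowMod => (x ^ y) %% z
  end.

(** [expect p mem f] is the expectation of [f out], where [out] is the output
    of [p] on input [mem] and the coins of [p] are uniform: [Coin a] draws from
    Z_k and [UnitCoin a] from Z_k^*, with k the value of [a]. *)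
Fixpoint expect (R : realFieldType) (p : prog) (mem : data) (f : data -> R) : R :=
  match p with
  | Out l => f (map (read mem) l)
  | Op o a b c q =>
      expect q (eval_op o (read mem a) (read mem b) (read mem c) :: mem) f
  | IfLt a b q1 q2 =>
      if read mem a < read mem b then expect q1 mem f else expect q2 mem f
  | Coin a q => avg (fun x : 'I_(read mem a) => expect q (val x :: mem) f)
  | UnitCoin a q =>
      avg (fun x : Zstar (read mem a) => expect q (val (val x) :: mem) f)
  end.

(** An arbitrary price list for the instructions; a price may depend on the
    operands (for instance through their bit lengths). *)
Record cost_model := CostModel {
  op_cost : opcode -> nat -> nat -> nat -> nat;
  test_cost : nat -> nat -> nat }.

(** Worst-case running time on input [mem], over all coins.  Coins are part of
    the input of an algorithm, as in P.Enc(m; r), so reading them is free. *)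
Fixpoint time (w : cost_model) (p : prog) (mem : data) : nat :=
  match p with
  | Out _ => 0
  | Op o a b c q =>
      let x := read mem a in let y := read mem b in let z := read mem c in
      op_cost w o x y z + time w q (eval_op o x y z :: mem)
  | IfLt a b q1 q2 =>
      let x := read mem a in let y := read mem b in
      test_cost w x y + (if x < y then time w q1 mem else time w q2 mem)
  | Coin a q => \max_(x : 'I_(read mem a)) time w q (val x :: mem)
  | UnitCoin a q =>
      \max_(x : Zstar (read mem a)) time w q (val (val x) :: mem)
  end.

(** * Conditional encryption *)

(** The coins of each algorithm are an explicit uniform argument.  The flag of
    a ciphertext is its first entry, and [None] is the failure symbol. *)
Record cond_scheme := CondScheme {
  msg : Type;
  msg_code : msg -> data;
  keygen_coins : nat -> finType;
  enc_coins : data -> finType;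
  condenc_coins : data -> finType;
  keygen : forall lam : nat, keygen_coins lam -> data * data;
  enc : forall pk : data, msg -> enc_coins pk -> data;
  condenc : forall pk : data, data -> msg -> msg -> condenc_coins pk -> option data;
  dec : data -> data -> option msg;
  enc_flag : forall pk m r, ohead (enc (pk := pk) m r) = Some 0;
  condenc_flag : forall pk c m2 m3 r c',
    condenc (pk := pk) c m2 m3 r = Some c' -> ohead c' = Some 1;
  condenc_bot : forall pk c m2 m3 r,
    ohead c = Some 1 -> condenc (pk := pk) c m2 m3 r = None }.

(** What a distinguisher receives; the last field is the challenge. *)
Record view (M : Type) := View {
  view_sk : data; view_pk : data;
  view_m1 : M; view_m2 : M; view_m3 : M;
  view_c1 : data; view_chal : option data }.

Definition block (d : data) : data := size d :: d.

Definition view_code (M : Type) (code : M -> data) (v : view M) : data :=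
  block (view_sk v) ++ block (view_pk v) ++ block (code (view_m1 v)) ++
  block (code (view_m2 v)) ++ block (code (view_m3 v)) ++ block (view_c1 v) ++
  (if view_chal v is Some c then 1 :: block c else [:: 0]).

(** The views that occur in the secrecy experiments at security parameter
    [lam]: the challenge is an output of CondEnc or a possible output of the
    simulator. *)
Definition occurs (R : realFieldType) (S : cond_scheme) (Sim : prog) (lam : nat)
    (v : view (msg S)) : Prop :=
  exists (r : keygen_coins S lam) (r1 : enc_coins S (keygen r).2),
    [/\ view_sk v = (keygen r).1, view_pk v = (keygen r).2,
        view_c1 v = enc (view_m1 v) r1 &
        (exists rho : condenc_coins S (keygen r).2,
           view_chal v = condenc (view_c1 v) (view_m2 v) (view_m3 v) rho) \/
        (exists2 c, view_chal v = Some c &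
           expect Sim (keygen r).2 (fun c' => ((c' == c)%:R : R)%R) <> 0%R)].

(** [D v] is the probability that the distinguisher outputs 1 on [v]. *)
Definition is_distinguisher (R : realFieldType) (M : Type) (D : view M -> R) :=
  forall v, (0 <= D v <= 1)%R.

(** The time bound [None] is infinity: no restriction at all.  Under a finite
    bound the distinguisher has to be given by a program. *)
Definition runs_within (R : realFieldType) (w : cost_model) (M : Type)
    (code : M -> data) (Dom : view M -> Prop) (D : view M -> R)
    (t : option nat) : Prop :=
  match t with
  | None => True
  | Some b => exists p : prog, forall v, Dom v ->
      time w p (view_code code v) <= b /\
      D v = expect p (view_code code v) (fun o => ((o == [:: 1])%:R)%R)
  end.

(** (t, t_Sim, eps)-conditional encryption secrecy for the predicate [P]. *)
Definition cond_enc_secrecy (R : realFieldType) (w : cost_model)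
    (S : cond_scheme) (P : msg S -> msg S -> bool)
    (t : nat -> option nat) (tSim : nat -> nat)
    (eps : option nat -> nat -> R) : Prop :=
  exists Sim : prog,
    (forall (lam : nat) (r : keygen_coins S lam),
       time w Sim (keygen r).2 <= tSim lam) /\
    (forall m1 m2 m3 : msg S, P m1 m2 = false ->
     forall (lam : nat) (r : keygen_coins S lam)
       (r1 : enc_coins S (keygen r).2) (D : view (msg S) -> R),
       is_distinguisher D ->
       runs_within w (@msg_code S) (@occurs R S Sim lam) D (t lam) ->
       let sk := (keygen r).1 in
       let pk := (keygen r).2 in
       let c1 := enc m1 r1 in
       (`| expect Sim pk (fun c => D (View sk pk m1 m2 m3 c1 (Some c)))
           - avg (fun rho : condenc_coins S pk =>
               D (View sk pk m1 m2 m3 c1 (condenc c1 m2 m3 rho))) |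
        <= eps (t lam) lam)%R).

(** * Paillier encryption *)

(** A key generator whose primes are at least [B]. *)
Record paillier_keygen (B : nat) := PaillierKeygen {
  pk_coins : nat -> finType;
  primes_of : forall lam : nat, pk_coins lam -> nat * nat;
  primes_ofP : forall (lam : nat) (r : pk_coins lam),
    let p := (primes_of r).1 in let q := (primes_of r).2 in
    [/\ prime p, prime q, p != q, B <= minn p q
      & gcdn (p * q) (p.-1 * q.-1) = 1] }.

Definition pk_mod (pk : data) : nat := nth 0 pk 0.
Definition pk_gen (pk : data) : nat := nth 0 pk 1.

Definition paillier_keys (B : nat) (K : paillier_keygen B) (lam : nat)
    (r : pk_coins K lam) : data * data :=
  let p := (primes_of r).1 in let q := (primes_of r).2 in
  ([:: p; q], [:: p * q; p * q + 1]).

Definition P_Enc (pk : data) (m r : nat) : nat :=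
  (pk_gen pk ^ m * r ^ pk_mod pk) %% (pk_mod pk) ^ 2.

(** [None] when [c] is not a Paillier ciphertext. *)
Definition P_Dec (sk : data) (c : nat) : option nat :=
  let N := nth 0 sk 0 * nth 0 sk 1 in
  omap val [pick m : 'I_N |
    [exists r : Zstar N, c == P_Enc [:: N; N + 1] m (val (val r))]].

(** P.Enc as a program, on input [:: N; g; m; r]: the square of N, two modular
    exponentiations, and a modular product. *)
Definition P_Enc_prog : prog :=
  Op Mul (Reg 0) (Reg 0) (Lit 0) (
  Op PowMod (Reg 2) (Reg 3) (Reg 0) (
  Op PowMod (Reg 5) (Reg 2) (Reg 1) (
  Op Mul (Reg 1) (Reg 0) (Lit 0) (
  Op Mod (Reg 0) (Reg 3) (Lit 0) (
  Out [:: Reg 0]))))).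

Lemma P_Enc_progE (R : realFieldType) (N g m r : nat) (f : data -> R) :
  expect P_Enc_prog [:: N; g; m; r] f = f [:: P_Enc [:: N; g] m r].
Proof. by rewrite /= modnMm mulnn. Qed.

(** The (worst-case) time of one Paillier encryption. *)
Definition t_P_Enc (w : cost_model) (B : nat) (K : paillier_keygen B)
    (lam : nat) : nat :=
  \max_(k : pk_coins K lam)
    let pk := (paillier_keys k).2 in
    \max_(m : 'I_(pk_mod pk)) \max_(r : Zstar (pk_mod pk))
      time w P_Enc_prog (pk ++ [:: val m; val (val r)]).

(** * Edit distance *)

Section EditDistance.
Variable Sigma : finType.
Implicit Types s m : seq Sigma.

(** [m] without its [i]-th character, counting from 1. *)
Definition del (i : nat) m : seq Sigma :=
  if 0 < i <= size m then take i.-1 m ++ drop i m else m.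

(** The results of one insertion or deletion. *)
Definition edit1 s : seq (seq Sigma) :=
  [seq del i s | i <- iota 1 (size s)] ++
  [seq take i s ++ a :: drop i s | i <- iota 0 (size s).+1, a <- enum Sigma].

(** [edits k s s'] : exactly [k] edits can turn [s] into [s']. *)
Fixpoint edits (k : nat) s s' : bool :=
  if k is k'.+1 then has (fun u => edits k' u s') (edit1 s) else s == s'.

Lemma edits_erase s s' k : edits k [::] s' -> edits (size s + k) s s'.
Proof.
elim: s => [//|a s IHs] Hk.
change (has (fun u => edits (size s + k) u s') (edit1 (a :: s))).
apply/hasP; exists s; last exact: IHs.
rewrite mem_cat; apply/orP; left; apply/mapP; exists 1; first by rewrite mem_iota.
by rewrite /del /= drop0.
Qed.

Lemma edits_append s s' : edits (size s') s (s ++ s').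
Proof.
elim: s' s => [|a s' IHs'] s; first by rewrite cats0 /= eqxx.
change (has (fun u => edits (size s') u (s ++ a :: s')) (edit1 s)).
apply/hasP; exists (rcons s a); last by rewrite -cat_rcons.
rewrite mem_cat; apply/orP; right; apply/allpairsP; exists (size s, a).
by split; rewrite ?mem_iota ?mem_enum //= take_size drop_size cats1.
Qed.

Lemma edits_ex s s' : exists k, edits k s s'.
Proof. by exists (size s + size s'); apply: edits_erase; exact: (edits_append [::]). Qed.

Definition ED s s' : nat := ex_minn (edits_ex s s').

Lemma size_del i m : size (del i m) <= size m.
Proof.
rewrite /del; case: ifP => // /andP[i_gt0 le_im].
rewrite size_cat size_takel ?size_drop ?(leq_trans (leq_pred i)) //.
by rewrite -[leqRHS](subnKC le_im) leq_add2r leq_pred.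
Qed.

Definition bdel (n i : nat) (m : n.-bseq Sigma) : n.-bseq Sigma :=
  Bseq (leq_trans (size_del i m) (size_bseq m)).

Definition P_ED (n : nat) (m m' : n.-bseq Sigma) : bool := ED m m' <= 1.

End EditDistance.

(** * The construction for edit distance one *)

Section Construction.
Variables (Sigma : finType) (n : nat).

(** The type of ToInt makes Z_(|Sigma|^(n+1)) the set of integers below the
    modulus. *)
Variable ToInt : n.-bseq Sigma -> 'I_(#|Sigma| ^ n.+1).
Variable K : paillier_keygen (#|Sigma| ^ n.+1).

Definition ToInt_inv (y : nat) : option (n.-bseq Sigma) :=
  [pick m | val (ToInt m) == y].

(** CondEnc for equality; the product is computed in the ring Z_(N^2), where
    the base N + 1 of the possibly negative exponent is a unit. *)
Definition CondEncEq (N c : nat) (m2 m3 : n.-bseq Sigma) (R : 'I_N) (r : Zstar N) :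
    option nat :=
  if gcdn c N == 1 then
    let e : int := (- (Posz R * Posz (ToInt m2)) + Posz (ToInt m3))%R in
    let y : 'Z_(N ^ 2) :=
      (c%:R ^+ R * (N + 1)%:R ^ e * (val (val r))%:R ^+ N)%R in
    Some (val y)
  else None.

Definition ED_enc_coins (pk : data) : finType :=
  {ffun 'I_n.+1 -> Zstar (pk_mod pk)}.

Definition ED_condenc_coins (pk : data) : finType :=
  {ffun 'I_(2 * n).+1 -> 'I_(pk_mod pk) * Zstar (pk_mod pk)}.

Definition ED_enc (pk : data) (m : n.-bseq Sigma) (r : ED_enc_coins pk) : data :=
  0 :: [seq P_Enc pk (ToInt (bdel i m)) (val (val (r i))) | i : 'I_n.+1].

(** Component [j] of the output of CondEnc on the ciphertext [0 :: b]. *)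
Definition ED_component (pk b : data) (m' m'' : n.-bseq Sigma)
    (rho : ED_condenc_coins pk) (j : 'I_(2 * n).+1) : option nat :=
  if j <= n then CondEncEq (nth 0 b j) m' m'' (rho j).1 (rho j).2
  else CondEncEq (nth 0 b 0) (bdel (j - n) m') m'' (rho j).1 (rho j).2.

(** Inputs that do not have the form [0 :: b] with [n + 1] entries in [b] are
    rejected. *)
Definition ED_condenc (pk c : data) (m' m'' : n.-bseq Sigma)
    (rho : ED_condenc_coins pk) : option data :=
  match c with
  | 0 :: b =>
      if size b == n.+1 then
        let cs := [seq ED_component b m' m'' rho j | j : 'I_(2 * n).+1] in
        if all isSome cs then Some (1 :: pmap id cs) else None
      else None
  | _ => None
  end.

Definition ED_dec (sk c : data) : option (n.-bseq Sigma) :=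
  match c with
  | 0 :: b =>
      if size b == n.+1 then obind ToInt_inv (P_Dec sk (nth 0 b 0)) else None
  | 1 :: b =>
      if size b == (2 * n).+1 then
        let xs := map (P_Dec sk) b in
        if all isSome xs then
          let ys := pmap id xs in
          let x := \big[minn/head 0 ys]_(y <- ys) y in
          if #|Sigma| ^ n.+1 < x then None else ToInt_inv x
        else None
      else None
  | _ => None
  end.

Definition str_code (m : n.-bseq Sigma) : data := [seq val (enum_rank a) | a <- m].

Lemma ED_enc_flag (pk : data) m (r : ED_enc_coins pk) : ohead (ED_enc m r) = Some 0.
Proof. by []. Qed.

Lemma ED_condenc_flag (pk c : data) m' m'' (rho : ED_condenc_coins pk) c' :
  ED_condenc c m' m'' rho = Some c' -> ohead c' = Some 1.
Proof. by case: c => [|[|x] b] //=; do 2!case: ifP => // _; case=> <-. Qed.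

Lemma ED_condenc_bot (pk c : data) m' m'' (rho : ED_condenc_coins pk) :
  ohead c = Some 1 -> ED_condenc c m' m'' rho = None.
Proof. by case: c => [|[|x] b]. Qed.

Definition Pi_ED : cond_scheme :=
  @CondScheme (n.-bseq Sigma) str_code (pk_coins K) ED_enc_coins ED_condenc_coins
    (@paillier_keys _ K) ED_enc ED_condenc ED_dec
    ED_enc_flag ED_condenc_flag ED_condenc_bot.

End Construction.

(* Main.v *)
(** If [b] differs from [a] then [a - b] is a unit modulo
    [N], because both are smaller than the prime factors of [N].  Hence for a
    ciphertext [c = g^a s^N] the coins [(R, r)] of [CondEncEq] yield the Paillier
    encryption of [R (a - b) + m3] with nonce [s^R r], and
    [(R, r) |-> (R (a - b) + m3, s^R r)] permutes [Z_N * Z_N^*].  When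
    [ED m1 m2 > 1] this applies to each of the [2 n + 1] components, which are
    therefore independent encryptions of uniform messages; the simulator
    samples these directly. *)

Require Import Defs.
From mathcomp Require Import all_boot all_order all_algebra.
From mathcomp Require Import ring.

Set Implicit Arguments.
Unset Strict Implicit.
Unset Printing Implicit Defensive.

Import GRing.Theory.

(** * Uniform averages and changes of variables *)

Section Average.
Variable R : realFieldType.

Lemma eq_avg (T : finType) (f g : T -> R) : f =1 g -> avg f = avg g.
Proof. by move=> fg; rewrite /avg (eq_bigr _ (fun x _ => fg x)). Qed.

Lemma avg_inj (T U : finType) (h : T -> U) (f : U -> R) :
  injective h -> #|U| <= #|T| -> avg (fun x => f (h x)) = avg f.
Proof.
move=> h_inj leUT; have h_bij := inj_card_bij h_inj leUT.
rewrite /avg (bij_eq_card h_bij); congr (_ / _)%R.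
by rewrite [RHS](reindex h) //; apply: onW_bij.
Qed.

Lemma avg_pair (T U : finType) (f : T * U -> R) :
  avg (fun x => avg (fun y => f (x, y))) = avg f.
Proof.
rewrite /avg -mulr_suml card_prod mulnC natrM invfM pair_bigA [RHS]mulrA.
by congr (_ * _ * _)%R; apply: eq_bigr; case.
Qed.

(** Successive independent draws amount to one draw of a function; peeling off the coordinate at
    [ord0] matches one round of [sim]. *)
Lemma avg_ffunS (T : finType) (k : nat) (f : {ffun 'I_k.+1 -> T} -> R) :
  avg f = avg (fun x => avg (fun s : {ffun 'I_k -> T} =>
    f [ffun i => oapp s x (unlift ord0 i)])).
Proof.
pose h (xs : T * {ffun 'I_k -> T}) : {ffun 'I_k.+1 -> T} :=
  [ffun i => oapp xs.2 xs.1 (unlift ord0 i)].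
rewrite -(@avg_inj _ _ h f); first by rewrite -avg_pair.
  move=> [x s] [y t] /ffunP eq_h; congr (_, _).
    by have:= eq_h ord0; rewrite !ffunE unlift_none.
  by apply/ffunP=> i; have:= eq_h (lift ord0 i); rewrite !ffunE liftK.
by rewrite card_prod !card_ffun !card_ord expnS.
Qed.

End Average.

(** * Output distribution and running time of the simulator *)

Section Simulator.

Definition shift (d : nat) (a : operand) : operand :=
  if a is Reg i then Reg (d + i) else a.

(** [sim k o l] outputs [l] followed by [k] encryptions of uniform messages,
    provided that registers [o] and [o.+1] contain the public key.  Each round
    pushes seven values. *)
Fixpoint sim (k o : nat) (l : seq operand) : prog :=
  if k is k'.+1 then
    Coin (Reg o) (UnitCoin (Reg o.+1) (
    Op Mul (Reg o.+2) (Reg o.+2) (Lit 0) (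
    Op PowMod (Reg o.+4) (Reg 2) (Reg 0) (
    Op PowMod (Reg 2) (Reg o.+4) (Reg 1) (
    Op Mul (Reg 1) (Reg 0) (Lit 0) (
    Op Mod (Reg 0) (Reg 3) (Lit 0) (
    sim k' (7 + o) (rcons (map (shift 7) l) (Reg 0)))))))))
  else Out l.

Definition enc_coin (pk : data) (x : 'I_(pk_mod pk) * Zstar (pk_mod pk)) : nat :=
  P_Enc pk x.1 (val (val x.2)).

Lemma expect_sim (R : realFieldType) (f : data -> R) (N g k o : nat)
    (l : seq operand) (mem : data) :
  nth 0 mem o = N -> nth 0 mem o.+1 = g ->
  expect (sim k o l) mem f =
  avg (fun rho : {ffun 'I_k -> 'I_N * Zstar N} =>
    f (map (read mem) l ++ [seq enc_coin (pk := [:: N; g]) (rho j) | j : 'I_k])).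
Proof.
move=> memN memg; elim: k => [|k IHk] in o l mem memN memg *.
  (* With no round left there is exactly one coin function, so the average is that of a constant. *)
  rewrite /avg /= (eq_bigr (fun _ => f (map (read mem) l))); last first.
    move=> rho _; congr f; rewrite /image_mem (size0nil (s := enum _)) ?cats0 //.
    by rewrite size_enum_ord.
  by rewrite sumr_const card_ffun card_ord expn0 divr1.
rewrite avg_ffunS -avg_pair /= memN; apply: eq_avg => x.
apply: eq_avg => y; rewrite memg IHk //; apply: eq_avg => rho; congr f.
rewrite map_rcons -cats1 -catA -map_comp; congr (_ ++ _).
  (* A register moved by [shift 7] reads its old value after the seven pushes of a round. *)
  by apply: eq_map; case.
rewrite /image_mem enum_ordSl /= ffunE unlift_none /= -map_comp; congr (_ :: _).
  by rewrite /enc_coin /P_Enc /pk_mod /= modnMm mulnn.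
by apply: eq_map => j /=; rewrite ffunE liftK.
Qed.

(** Coins are free, and a round executes the instructions of [P_Enc_prog] on the same operand
    values, so the costs agree for every price list. *)
Lemma time_sim (w : cost_model) (t N g k o : nat) (l : seq operand) (mem : data) :
  nth 0 mem o = N -> nth 0 mem o.+1 = g ->
  (forall (m : 'I_N) (r : Zstar N),
    time w P_Enc_prog [:: N; g; val m; val (val r)] <= t) ->
  time w (sim k o l) mem <= k * t.
Proof.
move=> memN memg le_t; elim: k => [//|k IHk] in o l mem memN memg *.
rewrite /= memN; apply/bigmax_leqP => x _.
apply/bigmax_leqP => y _; rewrite memg mulSn !addnA.
apply: leq_add; last exact: IHk.
by have:= le_t x y; rewrite /= addn0 !addnA.
Qed.

Lemma time_P_Enc_le (w : cost_model) (B : nat) (K : paillier_keygen B)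
    (lam : nat) (kr : pk_coins K lam) (N := pk_mod (paillier_keys kr).2)
    (m : 'I_N) (r : Zstar N) :
  time w P_Enc_prog ((paillier_keys kr).2 ++ [:: val m; val (val r)])
    <= t_P_Enc w K lam.
Proof.
apply: leq_trans (leq_bigmax kr); apply: leq_trans (leq_bigmax m).
exact: leq_bigmax r.
Qed.

End Simulator.

(** * Arithmetic modulo N and N^2 *)

Section ModularArithmetic.

Lemma exprD_sq0 (A : comNzRingType) (x y : A) (k : nat) : (y * y = 0 ->
  (x + y) ^+ k.+1 = x ^+ k.+1 + k.+1%:R * x ^+ k * y)%R.
Proof.
move=> yy0; elim: k => [|k IHk]; first by rewrite !expr1 expr0; ring.
rewrite exprS IHk -[k.+2%:R%R]natr1 !(exprS x).
move: (k.+1%:R)%R (x ^+ k)%R => c u.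
(* The two sides differ by a multiple of [y * y], inserted here as zero. *)
rewrite -[RHS]addr0 -(mulr0 (c * u)%R) -yy0; ring.
Qed.

(** Write z = kN + (z mod N). The linear term of the truncated binomial expansion has one factor N
    from the exponent and one from kN, and N^2 = 0. *)
Lemma natrX_mod_sqr (N x y : nat) : 1 < N -> x = y %[mod N] ->
  (x%:R ^+ N = y%:R ^+ N :> 'Z_(N ^ 2))%R.
Proof.
move=> N_gt1; suff mod_exp z : (z%:R ^+ N = (z %% N)%:R ^+ N :> 'Z_(N ^ 2))%R.
  by move=> eq_xy; rewrite mod_exp eq_xy -mod_exp.
have N2_gt1 : 1 < N ^ 2 by rewrite -(exp1n 2) ltn_exp2r.
have NN0 : (N%:R * N%:R = 0 :> 'Z_(N ^ 2))%R.
  by rewrite -natrM mulnn char_Zp.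
rewrite {1}(divn_eq z N) natrD natrM addrC.
case: N N_gt1 N2_gt1 NN0 => // N _ _ NN0; rewrite exprD_sq0; last first.
  by rewrite mulrACA NN0 mulr0.
rewrite [X in (_ + X)%R](_ : _ = 0)%R ?addr0 //.
by rewrite -mulrA mulrC -!mulrA NN0 !mulr0.
Qed.

Lemma eqn_modMl_coprime (N d x y : nat) : coprime d N ->
  (d * x == d * y %[mod N]) = (x == y %[mod N]).
Proof.
move=> co_dN; wlog le_yx : x y / y <= x.
  by move=> W; case: (leqP y x) => [|/ltnW] /W //; rewrite eq_sym => ->; rewrite eq_sym.
rewrite !eqn_mod_dvd ?leq_mul2l ?le_yx ?orbT // -mulnBr Gauss_dvdr //.
by rewrite coprime_sym.
Qed.

Lemma coprime_prime_mul (p q d : nat) : prime p -> prime q ->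
  0 < d -> d < minn p q -> coprime d (p * q).
Proof.
move=> p_pr q_pr d_gt0; rewrite leq_min => /andP[dp dq].
by rewrite coprimeMr ![coprime d _]coprime_sym !prime_coprime ?gtnNdvd.
Qed.

Lemma coprime_sub_mod (p q a b : nat) : prime p -> prime q -> a != b ->
  a < minn p q -> b < minn p q -> coprime (a + (p * q - b)) (p * q).
Proof.
move=> p_pr q_pr; have le_min : minn p q <= p * q.
  by rewrite (leq_trans (geq_minl _ _)) ?leq_pmulr ?prime_gt0.
case: (ltngtP a b) => // ab _ lta ltb; have lebN := leq_trans (ltnW ltb) le_min.
(* With N = p * q, the number is N - (b - a), which has the same gcd with N as b - a. *)
- have co_ba : coprime (b - a) (p * q).
    apply: coprime_prime_mul; rewrite ?subn_gt0 //.
    exact: leq_ltn_trans (leq_subr _ _) ltb.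
  have le_baN := leq_trans (leq_subr a b) lebN.
  rewrite addnBA // addnC -subnBA ?(ltnW ab) // /coprime -{2}(subnK le_baN).
  by rewrite gcdnDl gcdnC -gcdnDr subnK.
- rewrite addnBA // addnC -addnBA ?(ltnW ab) // /coprime gcdnC gcdnDl gcdnC.
  apply: coprime_prime_mul; rewrite ?subn_gt0 //.
  exact: leq_ltn_trans (leq_subr _ _) lta.
Qed.

End ModularArithmetic.

(** * [CondEncEq] on a ciphertext as a fresh Paillier encryption *)

Section ConditionalEncryption.

Lemma nonce_subproof (N k : nat) (s r : Zstar N) :
  {t : Zstar N | val (val t) = (val (val s) ^ k * val (val r)) %% N}.
Proof.
have N_gt0 : 0 < N by case: N s {r} => [[[]]|].
have co : coprime ((val (val s) ^ k * val (val r)) %% N) N.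
  by rewrite coprime_modl coprimeMl coprimeXl ?(valP s) ?(valP r).
by exists (exist _ (Ordinal (ltn_pmod _ N_gt0)) co).
Qed.

(** The message and the nonce of the output of [CondEncEq] on [P_Enc a s];
    the message [R (a - b) + m3] is written with [a + (N - b)] to stay in
    [nat]. *)
Definition cond_coins (N : nat) (s : Zstar N) (a b m3 : nat)
    (x : 'I_N * Zstar N) : 'I_N * Zstar N :=
  (Ordinal (ltn_pmod (x.1 * (a + (N - b)) + m3)
     (leq_ltn_trans (leq0n _) (ltn_ord x.1))),
   sval (nonce_subproof x.1 s x.2)).

(** The map is triangular: the message determines R because the coefficient of R is a unit, and then
    the nonce determines r because s^R is a unit. *)
Lemma cond_coins_inj (N : nat) (s : Zstar N) (a b m3 : nat) :
  coprime (a + (N - b)) N -> injective (cond_coins s a b m3).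
Proof.
move=> co_ab [R r] [R' r'] [/eqP]; rewrite eqn_modDr ![_ * (a + _)]mulnC.
rewrite eqn_modMl_coprime // !modn_small // => /eqP /val_inj <-.
move=> /(congr1 (fun t : Zstar N => val (val t))).
rewrite !(svalP (nonce_subproof _ _ _)) /= => /eqP.
rewrite eqn_modMl_coprime ?coprimeXl ?(valP s) // !modn_small //.
by move=> /eqP /val_inj /val_inj ->.
Qed.

Lemma natr_P_Enc (N m r : nat) : 1 < N ->
  ((P_Enc [:: N; N + 1] m r)%:R = (N + 1)%:R ^+ m * r%:R ^+ N :> 'Z_(N ^ 2))%R.
Proof.
move=> N_gt1; have N2_gt1 : 1 < N ^ 2 by rewrite -(exp1n 2) ltn_exp2r.
by rewrite /P_Enc /= Zp_nat_mod // natrM !natrX.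
Qed.

Lemma generator_expN (N : nat) : 1 < N -> ((N + 1)%:R ^+ N = 1 :> 'Z_(N ^ 2))%R.
Proof. by move=> N_gt1; rewrite (natrX_mod_sqr (y := 1)) ?expr1n ?modnDl. Qed.

Variables (Sigma : finType) (n : nat) (ToInt : n.-bseq Sigma -> 'I_(#|Sigma| ^ n.+1)).

(** The reductions modulo N in [cond_coins] are harmless: g^N = 1, and an N-th power modulo N^2
    depends only on its base modulo N. *)
Lemma CondEncEq_P_Enc (N a : nat) (s : Zstar N) (m2 m3 : n.-bseq Sigma)
    (x : 'I_N * Zstar N) : 1 < N -> val (ToInt m2) <= N ->
  CondEncEq ToInt (P_Enc [:: N; N + 1] a (val (val s))) m2 m3 x.1 x.2 =
  Some (enc_coin (pk := [:: N; N + 1]) (cond_coins s a (ToInt m2) (ToInt m3) x)).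
Proof.
move=> N_gt1 le_m2N; have N2_gt1 : 1 < N ^ 2 by rewrite -(exp1n 2) ltn_exp2r.
have co_s : coprime (val (val s)) N := valP s.
have co_g : coprime (N + 1) N by rewrite /coprime gcdnC gcdnDl gcdn1.
have g_unit : ((N + 1)%:R : 'Z_(N ^ 2))%R \is a GRing.unit.
  by rewrite unitZpE // coprime_sym coprimeXr.
have gN := generator_expN N_gt1.
rewrite /CondEncEq ifT; last first.
  rewrite /P_Enc /= -/(coprime _ _) -(@coprime_pexpr 2) // coprime_modl.
  by rewrite coprime_pexpr // coprimeMl !coprimeXl.
congr Some; rewrite -[RHS](modn_small (d := N ^ 2)) ?ltn_pmod ?(ltnW N2_gt1) //.
rewrite -val_Zp_nat //; congr val; rewrite /enc_coin !natr_P_Enc //=.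
rewrite (svalP (nonce_subproof _ _ _)) (expr_mod _ gN).
rewrite [in RHS](natrX_mod_sqr (y := val (val s) ^ x.1 * val (val x.2))) ?modn_mod //.
rewrite natrM natrX exprzDr // -PoszM -exprnN -exprnP !exprMn -!exprM.
set g := (N + 1)%:R%R in g_unit gN *; rewrite [(N * x.1)%N]mulnC.
(* The exponents R (N - b) and -R b give the same power, since g^N = 1. *)
suff -> : (g ^+ (x.1 * (a + (N - ToInt m2)) + ToInt m3) =
           g ^+ (a * x.1) * g ^- (x.1 * ToInt m2) * g ^+ ToInt m3)%R by ring.
rewrite exprD; congr (_ * _)%R; apply: (canRL (mulrK (unitrX _ g_unit))).
rewrite -exprD -mulnDr -addnA subnK // mulnDr exprD [(x.1 * N)%N]mulnC.
by rewrite (exprM g N) gN expr1n mulr1 mulnC.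
Qed.

End ConditionalEncryption.

(** * Strings at distance at most one *)

Section EditDistance.
Variable Sigma : finType.
Implicit Types s : seq Sigma.

Lemma ED_le (k : nat) s s' : edits k s s' -> ED s s' <= k.
Proof. by rewrite /ED; case: ex_minnP => m _ min_m /min_m. Qed.

Lemma ED_edit1 s s' : s' \in edit1 s -> ED s s' <= 1.
Proof. by move=> s'P; apply/ED_le/hasP; exists s'; rewrite ?s'P /=. Qed.

Lemma ED_del_l (i : nat) s : ED s (del i s) <= 1.
Proof.
rewrite /del; case: ifPn => [i_in|_]; last first.
  by apply: leq_trans (leq0n _); apply: ED_le => /=.
apply: ED_edit1; rewrite mem_cat; apply/orP; left; apply/mapP; exists i.
  by rewrite mem_iota add1n.
by rewrite /del i_in.
Qed.

(** Reinserting the lost character undoes the deletion; the insertion index is i - 1, because [del]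
    counts from 1 and insertions from 0. *)
Lemma ED_del_r (i : nat) s : ED (del i s) s <= 1.
Proof.
rewrite /del; case: ifPn => [/andP[i_gt0 le_i]|_]; last first.
  by apply: leq_trans (leq0n _); apply: ED_le => /=.
case: i i_gt0 le_i => // i _ lt_i /=; apply: ED_edit1.
rewrite mem_cat; apply/orP; right.
case: s lt_i => // a s lt_i; set t := a :: s in lt_i *.
have size_take_i : size (take i t) = i by rewrite size_takel // ltnW.
apply/allpairsP; exists (i, nth a t i); split; rewrite ?mem_enum //.
  by rewrite mem_iota size_cat size_take_i /= ltnS leq_addr.
rewrite /= take_size_cat ?drop_size_cat //.
by rewrite -drop_nth // cat_take_drop.
Qed.

End EditDistance.

Theorem theorem6 (R : realFieldType) (w : cost_model)
    (Sigma : finType) (n : nat)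
    (ToInt : n.-bseq Sigma -> 'I_(#|Sigma| ^ n.+1)) (ToInt_inj : injective ToInt)
    (K : paillier_keygen (#|Sigma| ^ n.+1)) :
  cond_enc_secrecy w (S := Pi_ED ToInt K) (@P_ED Sigma n)
    (fun _ => None)
    (fun lam => (2 * n + 1) * t_P_Enc w K lam)
    (fun _ _ => 0%R : R).
Proof.
(* [Lit 1] is the flag; the offset is 0 because the input memory is the public key itself. *)
exists (sim (2 * n).+1 0 [:: Lit 1]); split=> [lam kr|].
  rewrite addn1; apply: time_sim (erefl _) (erefl _) _ => m r.
  exact: (time_P_Enc_le w m r).
move=> m1 m2 m3 Pm lam kr r1 D _ _; lazy zeta.
set pk := (keygen _).2 in r1 *; set sk := (keygen _).1; set c1 := enc m1 r1.
rewrite (expect_sim _ _ _ (erefl (pk_mod pk)) (erefl (pk_gen pk))).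
have [p_pr q_pr neq_pq le_min co_N] := primes_ofP kr.
have ltN m : val (ToInt m) < minn (primes_of kr).1 (primes_of kr).2.
  exact: leq_trans (ltn_ord _) le_min.
set N := pk_mod pk; have defN : N = (primes_of kr).1 * (primes_of kr).2 by [].
have N_gt1 : 1 < N.
  by rewrite defN (leq_trans (prime_gt1 p_pr)) // leq_pmulr ?prime_gt0.
have leN m : val (ToInt m) <= N.
  rewrite ltnW // defN (leq_trans (ltN m)) // (leq_trans (geq_minl _ _)) //.
  by rewrite leq_pmulr ?prime_gt0.
(* Component [j] tests [a j] against [b j]; [bdel 0] leaves [m1] intact. *)
pose a (j : 'I_(2 * n).+1) := if j <= n then bdel j m1 else bdel 0 m1.
pose b (j : 'I_(2 * n).+1) := if j <= n then m2 else bdel (j - n) m2.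
pose s (j : 'I_(2 * n).+1) : Zstar N := if j <= n then r1 (inord j) else r1 ord0.
pose h (rho : ED_condenc_coins n pk) : ED_condenc_coins n pk :=
  [ffun j => cond_coins (s j) (ToInt (a j)) (ToInt (b j)) (ToInt m3) (rho j)].
(* Equality would turn one of [m1], [m2] into the other by at most one deletion, against [Pm]. *)
have neq_ab j : a j != b j.
  apply/eqP => /(congr1 (fun m : n.-bseq Sigma => m : seq Sigma)).
  move: Pm; rewrite /P_ED /a /b; case: ifP => _ /negP Pm /= eq_ab; apply: Pm.
    by rewrite -eq_ab ED_del_l.
  by move: eq_ab; rewrite {1}/del /= => ->; rewrite ED_del_r.
have h_inj : injective h.
  move=> rho rho' /ffunP eq_h; apply/ffunP => j; move: (eq_h j); rewrite !ffunE.
  apply: cond_coins_inj; apply: coprime_sub_mod; [by []|by []| |exact: ltN|exact: ltN].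
  by rewrite (inj_eq val_inj) (inj_eq ToInt_inj).
have componentE : forall (rho : ED_condenc_coins n pk) j,
    ED_component ToInt (behead c1) m2 m3 rho j = Some (enc_coin (h rho j)).
  move=> rho j; rewrite ffunE /ED_component /a /b /s /=.
  have nth_c1 (i : 'I_n.+1) : nth 0 (behead c1) i =
      P_Enc pk (ToInt (bdel i m1)) (val (val (r1 i))).
    by rewrite /= (nth_map ord0) ?size_enum_ord // nth_ord_enum.
  case: ifP => [le_jn|_].
    rewrite -{1}(inordK (m := j) (n' := n)) // nth_c1 inordK //.
    by rewrite CondEncEq_P_Enc.
  by rewrite (nth_c1 ord0) CondEncEq_P_Enc.
have condencE (rho : ED_condenc_coins n pk) :
    condenc (c0 := Pi_ED ToInt K) c1 m2 m3 rho =
    Some (1 :: [seq enc_coin (h rho j) | j : 'I_(2 * n).+1]).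
  rewrite /= size_map size_enum_ord eqxx /image_mem (eq_map (componentE rho)).
  by rewrite (map_comp Some) (map_pK (g := Some)) // all_map all_predT.
rewrite (eq_avg (fun rho =>
  congr1 (fun c => D (View sk pk m1 m2 m3 c1 c)) (condencE rho))).
(* Averaging over [h rho] is averaging over [rho], which is the simulated experiment. *)
rewrite (avg_inj (fun rho : ED_condenc_coins n pk =>
  D (View sk pk m1 m2 m3 c1
       (Some (1 :: [seq enc_coin (rho j) | j : 'I_(2 * n).+1]))))
  h_inj) //.
by rewrite subrr Num.Theory.normr0.
Qed.
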